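(* Let $G_1,G_2,\dots,G_k$ be finite groups having (pairwise) coprime orders. Then $$\psi'\Big(\prod_{i=1}^k G_i\Big)=\prod_{i=1}^k \psi'(G_i)^{n_i},\qquad\text{where } n_i=\prod_{\substack{1\le j\le k\\ j\neq i}}|G_j|,\quad i=1,2,\dots,k,$$ and $\prod_{i=1}^k G_i$ on the left-hand side denotes the direct product of the groups. In particular, if $G$ is a finite nilpotent group of order $n=p_1^{\alpha_1}p_2^{\alpha_2}\cdots p_k^{\alpha_k}$ (with $p_1,\dots,p_k$ distinct primes), $G_1,G_2,\dots,G_k$ are the Sylow subgroups of $G$ (with $G_i$ the Sylow $p_i$-subgroup), and $n_i=n/p_i^{\alpha_i}$ for $i=1,2,\dots,k$, then $$\psi'(G)=\prod_{i=1}^k\psi'(G_i)^{n_i}.$$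
   Context: For a finite group $G$, $\psi'(G)=\prod_{x\in G}o(x)$ denotes the product of the orders of all elements of $G$, where $o(x)$ is the order of $x\in G$. *)

(* Defs.v *)
From mathcomp Require Import all_boot all_fingroup all_solvable.

Set Implicit Arguments.
Unset Strict Implicit.
Unset Printing Implicit Defensive.

Import GroupScope.

(* A is a mere set, as in #|A|, so that psi' applies directly to sets with a
   canonical group structure, such as setXn G. *)
Definition psi' (gT : finGroupType) (A : {set gT}) : nat :=
  (\prod_(x in A) #[x])%N.

(* Main.v *)
Require Import Defs.
From mathcomp Require Import all_boot all_fingroup all_solvable.

Set Implicit Arguments.
Unset Strict Implicit.
Unset Printing Implicit Defensive.

Import GroupScope.

(* If G = A x B with #|A| and #|B| coprime, then the \pi(A)-part of #[a * b] is
   #[a], so the \pi(A)-parts of the orders of the elements of G multiply to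
   psi' A ^ #|B|.  When G has a family of direct factors A i whose coprime orders
   multiply to #|G|, the order of each x in G is the product of its \pi(A i)-parts,
   and exchanging the two products computes psi' G.  Both halves of the theorem
   are instances: the embedded factors of an external product, and the Sylow
   subgroups of a nilpotent group. *)

Lemma coprime_prodr (I : Type) (r : seq I) (P : pred I) (F : I -> nat) (m : nat) :
  (forall i, P i -> coprime m (F i)) -> coprime m (\prod_(i <- r | P i) F i)%N.
Proof.
move=> coF; elim/big_ind: _ => // [|a b co_a co_b]; first exact: coprimen1.
by rewrite coprimeMr co_a.
Qed.

(** The primes of [a * b] are those of [a] or of [b], and coprimality makes the two sets disjoint;
    the [\pi(a)^']-part of the left side is thus the [\pi(b)]-part of [n]. *)
Lemma partn_pi_coprimeM (a b n : nat) :
    0 < a -> 0 < b -> coprime a b ->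
  (n`_\pi((a * b)%N) = n`_\pi(a) * n`_\pi(b))%N.
Proof.
move=> a_gt0 b_gt0 co_ab; rewrite -(partnC \pi(a) (part_gt0 \pi((a * b)%N) n)).
have coab q : q \in primes b -> q \notin primes a.
  by move: co_ab; rewrite coprime_has_primes // => /hasPn; apply.
congr (_ * _)%N; rewrite -partnI; apply: eq_partn => q; rewrite !inE primesM //.
  by case: (q \in primes a); rewrite ?orbT ?andbF.
case bq: (q \in primes b); last by rewrite orbF andbN.
by rewrite orbT coab.
Qed.

Lemma partn_pi_coprime_prod (I : finType) (m : I -> nat) (n : nat) :
    (forall i, 0 < m i) ->
    (forall i j, i != j -> coprime (m i) (m j)) ->
  (n`_\pi(\prod_i m i) = \prod_i n`_\pi(m i))%N.
Proof.
move=> m_gt0 co_m; elim: index_enum (index_enum_uniq I) => [|i r IHr] /=.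
  by rewrite !big_nil /partn big_pred0.
case/andP=> r'i r_uniq; rewrite !big_cons -IHr // partn_pi_coprimeM ?prodn_gt0 //.
(* [big_seq] keeps the membership of [j] in [r], and [i] is not in [r], so [j] differs from [i]. *)
rewrite big_seq; apply: coprime_prodr => j rj.
by apply: co_m; apply: contraNneq r'i => ->.
Qed.

Lemma prod_order_part_dprod (gT : finGroupType) (A B G : {group gT}) :
    A \x B = G -> coprime #|A| #|B| ->
  (\prod_(x in G) #[x]`_\pi(A) = psi' A ^ #|B|)%N.
Proof.
move=> defG coAB; have [_ _ cAB _] := dprodP defG.
have part_order a b : a \in A -> b \in B -> (#[a * b]`_\pi(A) = #[a])%N.
  move=> Aa Bb.
  have piA_a : \pi(A).-elt a := mem_p_elt (pgroup_pi A) Aa.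
  have piA'_b : \pi(A)^'.-elt b.
    by apply: mem_p_elt Bb; rewrite /pgroup -coprime_pi' ?cardG_gt0.
  rewrite orderM; [|exact/esym/(centsP cAB)|exact: pnat_coprime piA_a piA'_b].
  by rewrite partnM // part_pnat_id // part_p'nat // muln1.
(* Multiplication is an isomorphism from the external product of [A] and [B] onto [G], so the
   product over [G] can be reindexed by pairs. *)
have /mulgmP/misomP[mulgmM /isomP[inj_mulgm im_mulgm]] := defG.
have -> : (\prod_(x in G) #[x]`_\pi(A) =
           \prod_(a in A) \prod_(b in B) #[a * b]`_\pi(A))%N.
  rewrite -im_mulgm /= morphimEdom big_imset; last exact/injmP.
  by rewrite pair_big; apply: eq_big => [u|[a b] _] /=; rewrite ?inE ?morphmE.
rewrite exchange_big /= -prod_nat_const; apply: eq_bigr => b Bb.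
by apply: eq_bigr => a Aa; apply: part_order.
Qed.

(** Each [A i] gets its own complement, with no iterated decomposition of [G], so that in the
    nilpotent case the complement can be a p'-core. *)
Lemma psi'_coprime_dprod (gT : finGroupType) (I : finType)
    (A : I -> {group gT}) (G : {group gT}) :
    (forall i, exists B : {group gT}, A i \x B = G) ->
    (forall i j, i != j -> coprime #|A i| #|A j|) ->
    #|G| = (\prod_i #|A i|)%N ->
  psi' G = (\prod_i psi' (A i) ^ (\prod_(j | j != i) #|A j|))%N.
Proof.
move=> factG coA oG.
have orderE x : x \in G -> #[x] = (\prod_i #[x]`_\pi(A i))%N.
  (* Every prime dividing [#[x]] divides [#|G|], so the [\pi(G)]-part of [#[x]] is [#[x]] itself. *)
  move=> Gx; have := partn_pi_coprime_prod #[x] (fun i => cardG_gt0 (A i)) coA.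
  by rewrite -oG part_pnat_id //; apply: mem_p_elt (pgroup_pi G) Gx.
rewrite /psi' (eq_bigr _ orderE) exchange_big /=; apply: eq_bigr => i _.
have [B defG] := factG i.
have oB : (\prod_(j | j != i) #|A j|)%N = #|B|.
  apply/eqP; rewrite -(eqn_pmul2l (cardG_gt0 (A i))) (dprod_card defG) oG.
  by rewrite [eqbRHS](bigD1 i).
rewrite oB; apply: prod_order_part_dprod => //.
rewrite -oB; apply: coprime_prodr => j ne_ji.
by apply: coA; rewrite eq_sym.
Qed.

(** Injective morphisms preserve element orders. This carries [psi'] from [G i] to its embedded copy
    in the external product. *)
Lemma psi'_morphim_inj (aT rT : finGroupType) (D : {group aT})
    (f : {morphism D >-> rT}) (A : {set aT}) :
  'injm f -> A \subset D -> psi' (f @* A) = psi' A.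
Proof.
move=> injf sAD; rewrite /psi' morphimEsub // big_imset /=.
  by apply: eq_bigr => x Ax; apply: order_injm => //; apply: (subsetP sAD).
by move=> x y Ax Ay; apply: (injmP injf); apply: (subsetP sAD).
Qed.

Theorem propositionA :
  (forall (k : nat) (gT : 'I_k -> finGroupType)
          (G : forall i : 'I_k, {group gT i}),
      (forall i j : 'I_k, i != j -> coprime #|G i| #|G j|) ->
      psi' (setXn G) =
        (\prod_(i < k) psi' (G i) ^ (\prod_(j < k | j != i) #|G j|))%N)
  /\
  (forall (gT : finGroupType) (G : {group gT}) (k : nat)
          (p alpha : 'I_k -> nat) (P : 'I_k -> {group gT}),
      nilpotent G ->
      (forall i : 'I_k, prime (p i)) ->
      injective p ->
      #|G| = (\prod_(i < k) p i ^ alpha i)%N ->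
      (forall i : 'I_k, (p i).-Sylow(G) (P i)) ->
      psi' G = (\prod_(i < k) psi' (P i) ^ (#|G| %/ p i ^ alpha i))%N).
Proof.
split=> [k gT G coG | gT G k p alpha P nilG p_pr inj_p oG sylP].
  have o1G i : #|set1gXn (G i)| = #|G i| by apply/esym/card_isog/isog_setXn.
  rewrite (@psi'_coprime_dprod _ _ (fun i => [group of set1gXn (G i)])
             [group of setXn G]) /=.
  - apply: eq_bigr => i _; rewrite (eq_bigr _ (fun j _ => o1G j)).
    by rewrite -morphim_dfung1 psi'_morphim_inj ?injm_dfung1 ?subsetT.
  (* The complement is the internal product of the other embedded factors. *)
  - move=> i; have := setXn_dprod G; rewrite (bigD1 i) //= => defG.
    by have [[_ B _ defB] _ _ _] := dprodP defG; exists B; rewrite -defB.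
  - by move=> i j; rewrite !o1G; apply: coG.
  - by rewrite cardsXn; apply: eq_bigr => i _; rewrite o1G.
have co_p i j : i != j -> coprime (p i ^ alpha i) (p j ^ alpha j).
  move=> ne_ij; rewrite coprimeXl // coprimeXr // prime_coprime // dvdn_prime2 //.
  by rewrite (inj_eq inj_p).
have p_gt0 i : 0 < p i ^ alpha i by rewrite expn_gt0 prime_gt0.
(* The primes are distinct, so the other factors of [#|G|] contribute nothing to its [p i]-part. *)
have oP i : #|P i| = (p i ^ alpha i)%N.
  rewrite (card_Hall (sylP i)) oG (bigD1 i) //= partnM ?prodn_gt0 //.
  rewrite part_pnat_id ?pnatX ?pnat_id // part_p'nat ?muln1 //.
  rewrite p'natE // -prime_coprime //; apply: coprime_prodr => j ne_ji.
  rewrite coprimeXr // prime_coprime // dvdn_prime2 //.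
  by rewrite (inj_eq inj_p) eq_sym.
rewrite (@psi'_coprime_dprod _ _ P G).
- apply: eq_bigr => i _; rewrite oG [in RHS](bigD1 i) //= mulKn //.
  by rewrite (eq_bigr _ (fun j _ => oP j)).
(* By nilpotency [P i] is the [p i]-core of [G], a direct factor complemented by the p'-core. *)
- move=> i; exists 'O_(p i)^'(G)%G; rewrite (nilpotent_Hall_pcore nilG (sylP i)).
  exact: nilpotent_pcoreC.
- by move=> i j; rewrite !oP; apply: co_p.
by rewrite oG; apply: eq_bigr => i _; rewrite oP.
Qed.
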